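(* Let $n\ge1$ and let $A$ and $B$ be smooth $\mathbb{R}_{0,m}$-valued functions depending only on $\underline{y}$. The function $$F(X)=\exp(z)A(\underline{y})+\exp(\overline{z})B(\underline{y})$$ is left $n$-monogenic (i.e. $\partial_X^nF=0$) if and only if $\Delta^nA(\underline{y})=0$ and $$B(\underline{y})=\sum_{k=1}^n c_k\,\partial_{\underline{y}}^{2k-1}A(\underline{y}),$$ where the real constants $c_k$ are defined recursively by $$c_1=-\tfrac12,\qquad c_k=-\frac{1}{2^k}\sum_{j=1}^{\lfloor k/2\rfloor}\sum_{i=1}^{j}\binom{k+1}{2j+1}\binom{j}{i}c_{k-i},\quad k\ge2.$$
   Context: Let $m\ge 2$ and let $\mathbb{R}_{0,m}$ be the real Clifford algebra generated by $e_1,\dots,e_m$ with $e_i^2=-1$ and $e_ie_j=-e_je_i$ for $i\neq j$; all products are Clifford products. Identify $(x_0,\dots,x_m)\in\mathbb{R}^{m+1}$ with $X=x_0+\sum_{j=1}^m x_je_j$, and write $z=x_0+x_1e_1$, $\overline{z}=x_0-x_1e_1$, $\underline{y}=\sum_{j=2}^m x_je_j$; $\exp(z)=e^{x_0}(\cos x_1+e_1\sin x_1)$, $\exp(\overline z)=e^{x_0}(\cos x_1-e_1\sin x_1)$. Operators: $\partial_X f=\partial_{x_0}f+\sum_{j=1}^m e_j\partial_{x_j}f$, $\partial_{\underline{y}}f=\sum_{j=2}^m e_j\partial_{x_j}f$; powers denote iterated left application. $\Delta=\sum_{j=2}^m\partial_{x_j}^2=-\partial_{\underline{y}}^2$. 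*)

(* Defs.v *)
From HB Require Import structures.
From mathcomp Require Import all_boot all_order all_algebra.
From mathcomp Require Import all_classical all_reals all_analysis.
Set Implicit Arguments. Unset Strict Implicit. Unset Printing Implicit Defensive.
Import Order.TTheory GRing.Theory Num.Theory.
Import numFieldNormedType.Exports.
Local Open Scope ring_scope.

Section Clifford.
Variable R : realType.
Variable m : nat.

(* The real Clifford algebra R_{0,m}: elements are real coefficient families
   indexed by subsets S of {1..m} (encoded as {set 'I_m}, index i <-> e_{i+1});
   a coefficient family a stands for \sum_S a S e_S with e_S the ordered product. *)
Definition Cl := {ffun {set 'I_m} -> R}.

(* sign of e_S e_T = +- e_{S Δ T}, using e_i^2 = -1 and e_i e_j = - e_j e_i *)
Definition clsign (S T : {set 'I_m}) : R :=
  (-1) ^+ (#|finset (fun p : 'I_m * 'I_m => (p.1 \in S) && (p.2 \in T) && (p.2 < p.1)%N)|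
           + #|S :&: T|).

Definition symdiff (S T : {set 'I_m}) : {set 'I_m} := (S :\: T) :|: (T :\: S).

Definition clmul (a b : Cl) : Cl :=
  [ffun U => \sum_(S : {set 'I_m}) \sum_(T : {set 'I_m} | symdiff S T == U)
               clsign S T * a S * b T].

Definition blade (S : {set 'I_m}) : Cl := [ffun U => (U == S)%:R].
Definition clone : Cl := blade (finset (fun _ : 'I_m => false)).
Definition gen (i : 'I_m) : Cl := blade (finset (pred1 i)).
(* e_1 (requires m >= 1 to be nonzero-indexed; the set {i | i = 0}) *)
Definition e1 : Cl := blade (finset (fun i : 'I_m => val i == 0%N)).

Notation pt := 'rV[R]_(m.+1).
Definition coord (X : pt) (k : nat) : R := X 0 (inord k).

Definition pdR (k : 'I_m.+1) (g : pt -> R) : pt -> R :=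
  fun X => derive g X (delta_mx 0 k).
Definition ipdR (l : seq 'I_m.+1) (g : pt -> R) : pt -> R := foldr pdR g l.
Definition smoothR (g : pt -> R) : Prop :=
  forall (l : seq 'I_m.+1) (X : pt), differentiable (ipdR l g) X.
Definition smooth (F : pt -> Cl) : Prop := forall S, smoothR (fun X => F X S).

Definition pd (k : 'I_m.+1) (F : pt -> Cl) : pt -> Cl :=
  fun X => [ffun S => pdR k (fun Y => F Y S) X].

Definition DX (F : pt -> Cl) : pt -> Cl :=
  fun X => pd ord0 F X + \sum_(i : 'I_m) clmul (gen i) (pd (lift ord0 i) F X).
Definition Dy (F : pt -> Cl) : pt -> Cl :=
  fun X => \sum_(i : 'I_m | (0 < val i)%N) clmul (gen i) (pd (lift ord0 i) F X).
Definition Lap (F : pt -> Cl) : pt -> Cl :=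
  fun X => \sum_(i : 'I_m | (0 < val i)%N) pd (lift ord0 i) (pd (lift ord0 i) F) X.

(* exp(z) and exp(zbar), z = x0 + x1 e1 *)
Definition expz (X : pt) : Cl :=
  (expR (coord X 0) * cos (coord X 1)) *: clone + (expR (coord X 0) * sin (coord X 1)) *: e1.
Definition expzbar (X : pt) : Cl :=
  (expR (coord X 0) * cos (coord X 1)) *: clone - (expR (coord X 0) * sin (coord X 1)) *: e1.

Definition only_y (F : pt -> Cl) : Prop :=
  forall X Y : pt, (forall k : 'I_m.+1, (2 <= val k)%N -> X 0 k = Y 0 k) -> F X = F Y.

End Clifford.

(* The constants c_k:  c_1 = -1/2,
   c_k = -(1/2^k) sum_{j=1}^{floor(k/2)} sum_{i=1}^{j} C(k+1,2j+1) C(j,i) c_{k-i}.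
   clist R k = [:: c_1; ...; c_k]. *)
Definition cnext (R : realType) (k : nat) (s : seq R) : R :=
  if k == 1%N then - 2^-1
  else - (2 ^+ k)^-1 *
       \sum_(1 <= j < (k./2).+1) \sum_(1 <= i < j.+1)
          ('C(k.+1, j.*2.+1) * 'C(j, i))%:R * nth 0 s (k - i).-1.

Fixpoint clist (R : realType) (k : nat) : seq R :=
  match k with
  | 0 => [::]
  | k'.+1 => rcons (clist R k') (cnext k'.+1 (clist R k'))
  end.

Definition cconst (R : realType) (k : nat) : R := nth 0 (clist R k) k.-1.

(* Main.v *)
Require Import Defs.
From HB Require Import structures.
From mathcomp Require Import all_boot all_order all_algebra.
From mathcomp Require Import all_classical all_reals all_analysis.
From mathcomp Require Import ring.
Import Order.TTheory GRing.Theory Num.Theory.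
Import numFieldNormedType.Exports.
Local Open Scope ring_scope.
Set Implicit Arguments. Unset Strict Implicit. Unset Printing Implicit Defensive.

(** Let [D] be the Dirac operator in the [y] variables. Since [D] exchanges
    [exp(z)] and [exp(zbar)], and [d_x0 + e_1 d_x1] kills [exp(z)] and doubles
    [exp(zbar)], the operator [DX] maps [exp(z) A + exp(zbar) B] to the same
    expression for [(D B, D A + 2 B)]. With [T = D^2] and the polynomials
    [U_0 = 0], [U_1 = 1], [U_(n+2) = 2 U_(n+1) + T U_n], the [n]-th iterate vanishes
    iff [U_n D B + T U_(n-1) A = 0] and [U_(n+1) B + U_n D A = 0].
    The Cassini identity gives [T^n A = T^n B = 0], and as [U_(n+1)] has constant
    term [2^n] it is invertible modulo [T^n], so that [B = - (U_n / U_(n+1)) D A].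
    The recursion for [c_k] says exactly that [sum_k c_k T^(k-1)] agrees with
    [- U_n / U_(n+1)] modulo [T^n]. Finally [D^2 = - Lap] by the symmetry of
    second derivatives. *)

(** * The constants [c_k] and the iteration of [(A, B) |-> (D B, D A + 2 B)] *)

(** The Lucas sequence with parameters [2] and [- 'X]; the variable stands for [T = D^2]. *)
Fixpoint lucasU (R : comNzRingType) (n : nat) : {poly R} :=
  match n with
  | 0 => 0
  | n'.+1 => match n' with
             | 0 => 1
             | n''.+1 => 2%:R * lucasU R n' + 'X * lucasU R n''
             end
  end.

Arguments lucasU : simpl never.

Section LucasPolynomials.
Variable R : comNzRingType.
Local Notation U := (lucasU R).

Lemma lucasUSS n : U n.+2 = 2%:R * U n.+1 + 'X * U n.
Proof. by []. Qed.

Lemma lucasU0 : U 0 = 0. Proof. by []. Qed.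
Lemma lucasU1 : U 1 = 1. Proof. by []. Qed.

(** The recurrence multiplies [U n.+1 ^+ 2 - U n * U n.+2] by [- 'X] at each step. The extra factor
    ['X] gives the products that arise when [a] or [b] is eliminated from the two vanishing
    conditions. *)
Lemma lucasU_cassini n : 'X * (U n.+1 ^+ 2 - U n * U n.+2) = - (- 'X) ^+ n.+1.
Proof.
elim: n => [|n IH]; first by rewrite lucasUSS lucasU0 lucasU1; ring.
rewrite [in RHS]exprS -[(- 'X) ^+ n.+1]opprK -IH (lucasUSS n.+1) (lucasUSS n); ring.
Qed.

Lemma coef0_lucasU n : (U n.+1)`_0 = 2%:R ^+ n.
Proof.
elim: n => [|n IH]; first by rewrite lucasU1 coef1.
rewrite lucasUSS coefD coefXM addr0 exprS -IH -polyC_natr coefCM //.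
Qed.

(* Writing [s = sqrt (1 + 'X)], one has [2 s U_n = (1 + s)^n - (1 - s)^n]; the
   second sum is the companion [((1 + s)^n + (1 - s)^n) / 2]. *)
Lemma lucasU_binomial N n : (n <= N)%N ->
  U n = \sum_(j < N) 'C(n, j.*2.+1)%:R * (1 + 'X) ^+ j /\
  U n.+1 - U n = \sum_(j < N.+1) 'C(n, j.*2)%:R * (1 + 'X) ^+ j.
Proof.
elim: n => [|n IH] nN.
  split; first by rewrite big1 // => i _; rewrite bin0n mul0r.
  rewrite lucasU0 lucasU1 big_ord_recl bin0n /= big1 => [|i _]; first by ring.
  by rewrite bin0n /= mul0r.
have [IHo IHe] := IH (ltnW nN).
have Uo : U n.+1 = \sum_(j < N) 'C(n.+1, j.*2.+1)%:R * (1 + 'X) ^+ j.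
  rewrite -[LHS](subrK (U n)) IHe {1}IHo big_ord_recr /=.
  rewrite (@bin_small n N.*2) ?mul0r ?addr0; last first.
    by rewrite -addnn; apply: leq_trans nN (leq_addr _ _).
  by rewrite -big_split /=; apply: eq_bigr => j _; rewrite binS natrD; ring.
split => //.
(* Multiplication by [1 + s] with [s^2 = 1 + 'X] sends the even part to even plus [1 + 'X] times
   odd; on coefficients this is Pascal's rule. *)
have -> : U n.+2 - U n.+1 = (U n.+1 - U n) + (1 + 'X) * U n.
  by rewrite lucasUSS; ring.
rewrite IHe {1}IHo big_ord_recl [RHS]big_ord_recl /= !bin0 -addrA; congr (_ + _).
rewrite mulr_sumr -big_split /=; apply: eq_bigr => j _.
by rewrite /bump /= add1n doubleS binS natrD exprS; ring.
Qed.

Lemma coef_1DXn j i : ((1 + 'X) ^+ j : {poly R})`_i = 'C(j, i)%:R.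
Proof.
elim: j i => [|j IH] [|i]; rewrite ?expr0 ?coef1 ?bin0 //
  exprS mulrDl mul1r coefD coefXM IH.
  by rewrite addr0 bin0.
by rewrite IH binS natrD.
Qed.

(** Expanding the powers of [1 + 'X] in the binomial formula produces exactly the weights in the
    recursion for [c_k]. *)
Lemma coef_lucasU k i :
  (U k.+1)`_i = \sum_(j < k./2.+1) ('C(k.+1, j.*2.+1) * 'C(j, i))%:R.
Proof.
have kk : (k./2.+1 <= k.+1)%N by rewrite ltnS leq_half_double -addnn leqW ?leq_addr.
have [-> _] := @lucasU_binomial k.+1 k.+1 (leqnn _).
rewrite coef_sum (big_ord_widen _ (fun j => ('C(k.+1, j.*2.+1) * 'C(j, i))%:R) kk).
rewrite [RHS]big_mkcond; apply: eq_bigr => j _.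
rewrite -polyC_natr coefCM coef_1DXn -natrM.
case: ifP => // /negbT; rewrite -leqNgt => jk; rewrite bin_small ?mul0n //.
by rewrite ltnS -ltn_half_double.
Qed.

End LucasPolynomials.

(** * The recursion for [c_k] as a congruence between polynomials *)

Section Constants.
Variable R : realType.
Local Notation U := (lucasU R).
Local Notation c := (cconst R).

Lemma size_clist k : size (clist R k) = k.
Proof. by elim: k => //= k IH; rewrite size_rcons IH. Qed.

Lemma nth_clist k i : (i < k)%N -> nth 0 (clist R k) i = c i.+1.
Proof.
elim: k => // k IH; rewrite ltnS leq_eqVlt => /predU1P[-> //|ik].
by rewrite /= nth_rcons size_clist ik IH.
Qed.

Lemma cconstS k : c k.+1 = cnext k.+1 (clist R k).
Proof. by rewrite /cconst /= nth_rcons size_clist ltnn eqxx. Qed.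

(** The term [i = 0] is [2^k c_k], and the recursion makes it cancel the others. The sum is the
    coefficient of ['X^(k-1)] in the product of [U k.+1] with the series of the [c_j 'X^(j-1)]. *)
Lemma cconst_lucasU k : (2 <= k)%N -> \sum_(i < k) (U k.+1)`_i * c (k - i)%N = 0.
Proof.
case: k => // k k1; rewrite big_ord_recl subn0 coef0_lucasU cconstS /cnext.
rewrite (gtn_eqF k1) mulNr mulrN mulrA divff ?mul1r; last first.
  by rewrite expf_neq0 ?pnatr_eq0.
apply/eqP; rewrite addrC subr_eq0; apply/eqP.
under eq_bigr => i _ do rewrite coef_lucasU mulr_suml.
(* The term [j = 0] vanishes because [i] is positive here, so the outer sum starts at 1 as in
   [cnext]. *)
rewrite exchange_big big_ord_recl /= big1 ?add0r; last first.
  by move=> i _; rewrite (@bin_small 0) // muln0 mul0r.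
rewrite big_add1 /= big_mkord; apply: eq_bigr => j _.
have jk : (j.+1 <= k)%N.
  have : (j < k.+1./2)%N := ltn_ord j; rewrite gtn_half_double ltnS -addnn => jk.
  by apply: leq_trans jk; rewrite -addSn leq_addr.
rewrite big_add1 /= big_mkord.
(* The inner sum may run past [j], since ['C(j, i)] is zero there. *)
rewrite [RHS](big_ord_widen _ (fun i => ('C(k.+2, (j.+1).*2.+1) * 'C(j.+1, i.+1))%:R *
  nth 0 (clist R k) (k.+1 - i.+1).-1) jk).
rewrite [RHS]big_mkcond; apply: eq_bigr => i _; rewrite /bump /= !add1n.
case: ifP => [ij|/negbT]; last first.
  by rewrite -leqNgt => ji; rewrite (@bin_small j.+1) ?ltnS // muln0 mul0r.
have ki : (0 < k - i)%N by rewrite subn_gt0.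
rewrite subSS nth_clist ?prednK //.
exact: leq_subr.
Qed.

(** The index is shifted because [D^(2k-1) A = T^(k-1) (D A)]. *)
Definition cpoly (n : nat) : {poly R} := \poly_(i < n) c i.+1.

Lemma cpolyS n : cpoly n.+1 = cpoly n + c n.+1 *: 'X^n.
Proof. by rewrite /cpoly !poly_def big_ord_recr. Qed.

(** Two-step induction: the recurrence for [U] yields all powers of ['X] but the last, and the
    recursion for [c_k] supplies that one. *)
Lemma lucasU_cpoly n : exists Q : {poly R}, U n.+1 * cpoly n + U n = 'X^n * Q.
Proof.
elim/ltn_ind: n => -[|[|n]] IH.
- by exists (U 1 * cpoly 0 + U 0); rewrite expr0 mul1r.
(* The value [c_1 = -1/2] makes [U 2 * c_1 + U 1] vanish exactly. *)
- exists 0; rewrite cpolyS /cpoly poly_def big_ord0 lucasUSS lucasU0 lucasU1 expr0.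
  rewrite cconstS /cnext /=.
  by rewrite add0r -mul_polyC !mulr0 addr0 !mulr1 -polyC_natr -polyCM -polyCD;
    rewrite mulrN divff ?pnatr_eq0 // addNr.
have [Q1 IH1] := IH n (ltnW (ltnSn _)); have [Q2 IH2] := IH n.+1 (ltnSn _).
pose Q : {poly R} := 2%:R * Q2 + Q1 + c n.+1 *: U n.+1 + c n.+2 *: U n.+3.
have E : U n.+3 * cpoly n.+2 + U n.+2 = 'X^(n.+1) * Q.
  transitivity (2%:R * (U n.+2 * cpoly n.+1 + U n.+1) + 'X * (U n.+1 * cpoly n + U n)
    + 'X * ((c n.+1)%:P * 'X^n * U n.+1) + (c n.+2)%:P * 'X^(n.+1) * U n.+3).
    by rewrite (cpolyS n.+1) (cpolyS n) (lucasUSS _ n.+1) [in X in _ + X](lucasUSS _ n)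
      -!mul_polyC !exprS; ring.
  by rewrite IH1 IH2 /Q -!mul_polyC !exprS; ring.
(* This is the coefficient of ['X^(n+1)]: [U n.+2] has none, its degree being too small, and the
   product contributes the sum that [cconst_lucasU] kills. *)
have Q0 : Q`_0 = 0.
  have := congr1 (fun p : {poly R} => p`_n.+1) E.
  rewrite coefXnM ltnn subnn => <-; rewrite coefD coefM.
  rewrite [X in _ + X]coef_lucasU [X in _ + X]big1 ?addr0 => [|j _]; last first.
    rewrite (@bin_small j) ?muln0 //; apply: leq_trans (ltn_ord j) _.
    by rewrite ltnS leq_half_double -addnn ltnS leq_addr.
  rewrite -[RHS](@cconst_lucasU n.+2) //; apply: eq_bigr => i _.
  by rewrite coef_poly ltnS leq_subr (@subSn i n.+1) // -ltnS ltn_ord.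
exists (drop_poly 1 Q).
rewrite E [in RHS]exprSr -[RHS]mulrA; congr (_ * _).
rewrite mulrC -[LHS](poly_take_drop 1) expr1 [take_poly _ _](_ : _ = 0) ?add0r //.
by apply/polyP => i; rewrite coef_take_poly coef0; case: i.
Qed.

End Constants.

(** * Polynomials acting on a module through an endomorphism *)

Section PolynomialAction.
Variables (R : comNzRingType) (V : lmodType R) (L : {linear V -> V}).

(** The value [p(L) u]; by [pactM] polynomial identities become identities of operators. *)
Definition pact (p : {poly R}) (u : V) : V := \sum_(i < size p) p`_i *: iter i L u.

Lemma pactE N (p : {poly R}) (u : V) : (size p <= N)%N ->
  pact p u = \sum_(i < N) p`_i *: iter i L u.
Proof.
move=> pN; rewrite /pact (big_ord_widen _ (fun i => p`_i *: iter i L u) pN).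
rewrite big_mkcond; apply: eq_bigr => i _; case: ifP => // /negbT.
by rewrite -leqNgt => pi; rewrite nth_default ?scale0r.
Qed.

Lemma pactDl p q u : pact (p + q) u = pact p u + pact q u.
Proof.
pose N := maxn (size p) (size q).
rewrite !(@pactE N) ?leq_maxl ?leq_maxr ?size_polyD // -big_split.
by apply: eq_bigr => i _; rewrite coefD scalerDl.
Qed.

Lemma pactC c u : pact c%:P u = c *: u.
Proof. by rewrite (@pactE 1) ?size_polyC_leq1 // big_ord1 coefC. Qed.

Lemma pact0 u : pact 0 u = 0.
Proof. by rewrite -polyC0 pactC scale0r. Qed.

Lemma pact1 u : pact 1 u = u.
Proof. by rewrite -polyC1 pactC scale1r. Qed.

Lemma pact_is_linear p : linear (pact p).
Proof.
have iterL i : linear (iter i L) by elim: i => // i IH a u v; rewrite !iterS IH linearP.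
move=> a u v; rewrite scaler_sumr -big_split; apply: eq_bigr => i _ /=.
by rewrite iterL scalerDr !scalerA mulrC.
Qed.
HB.instance Definition _ p := GRing.isLinear.Build R V V _ (pact p) (pact_is_linear p).

Lemma pactMX p u : pact (p * 'X) u = L (pact p u).
Proof.
rewrite (@pactE (size p).+1); last first.
  by rewrite (leq_trans (size_polyMleq _ _)) // size_polyX addn2.
rewrite big_ord_recl coefMX scale0r add0r.
by rewrite linear_sum; apply: eq_bigr => i _; rewrite coefMX linearZ.
Qed.

Lemma pactM p q u : pact (p * q) u = pact p (pact q u).
Proof.
elim/poly_ind: p => [|p c IH].
  by rewrite mul0r !pact0.
rewrite mulrDl pactDl [RHS]pactDl pactMX -mulrA ['X * q]mulrC mulrA pactMX IH.
congr (_ + _); rewrite pactC mul_polyC.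
rewrite (@pactE (size q)) ?size_scale_leq // scaler_sumr.
by apply: eq_bigr => i _; rewrite coefZ scalerA.
Qed.

Lemma pactXn n u : pact 'X^n u = iter n L u.
Proof.
by elim: n => [|n IH]; rewrite ?expr0 ?pactC ?scale1r // exprSr pactMX IH.
Qed.

Lemma pactNl p u : pact (- p) u = - pact p u.
Proof. by rewrite -mulN1r pactM -polyCN pactC scaleN1r. Qed.

Lemma pactCA p q u : pact p (pact q u) = pact q (pact p u).
Proof. by rewrite -!pactM mulrC. Qed.

End PolynomialAction.

(** * Vanishing of the iterates of the coefficient map *)

Section PairIteration.
Variables (R : realType) (V : lmodType R) (D : {linear V -> V}).
Local Notation U := (lucasU R).
Local Notation c := (cconst R).
Local Notation act := (pact (D \o D)).

Definition pair_step (ab : V * V) : V * V := (D ab.2, D ab.1 + 2%:R *: ab.2).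

Lemma pactD p u : D (act p u) = act p (D u).
Proof.
rewrite linear_sum; apply: eq_bigr => i _; rewrite linearZ; congr (_ *: _).
by elim: (val i) => //= j ->.
Qed.

Lemma pactDXM p u : act ('X * p) u = D (act p (D u)).
Proof. by rewrite mulrC pactMX /= pactD. Qed.

(** [D] commutes with polynomials in [D^2], so each step reproduces the recurrence for [U]. Starting
    from the first iterate avoids [U] at index [-1]. *)
Lemma iter_pair_step k a b : iter k.+1 pair_step (a, b) =
  (act (U k.+1) (D b) + act ('X * U k) a, act (U k.+1) (D a) + act (U k.+2) b).
Proof.
elim: k => [|k IH].
  by rewrite /pair_step lucasUSS lucasU0 lucasU1 mulr0 mulr1 !addr0 pact0 addr0
    !pact1 -polyC_natr pactC.
rewrite iterS IH /pair_step /=; congr pair.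
  by rewrite addrC linearD pactDXM !pactD.
rewrite linearD -pactDXM pactD scalerDr addrC [in LHS](addrC (act _ b)) addrACA.
have actUSS j u : act (U j.+2) u = 2%:R *: act (U j.+1) u + act ('X * U j) u.
  by rewrite lucasUSS pactDl -polyC_natr pactM pactC.
by rewrite (actUSS k (D a)) (actUSS k.+1 b).
Qed.

Lemma iter_pair_step_eq0 n a b : (0 < n)%N ->
  iter n pair_step (a, b) = 0 <->
  (iter n (D \o D) a = 0 /\
   b = \sum_(1 <= k < n.+1) cconst R k *: iter (k.*2.-1) D a).
Proof.
case: n => // k _.
have -> : \sum_(1 <= i < k.+2) cconst R i *: iter (i.*2.-1) D a =
    act (cpoly R k.+1) (D a).
  rewrite big_add1 big_mkord (@pactE _ _ _ k.+1) ?size_poly //.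
  apply: eq_bigr => i _; rewrite coef_poly ltn_ord; congr (_ *: _).
  by elim: (val i) => //= j ->.
have [Q EQ] := lucasU_cpoly R k.+1; have [Q' EQ'] := lucasU_cpoly R k.
rewrite iter_pair_step -pactXn; split.
  move=> [/eqP]; rewrite addr_eq0 => /eqP E1 /eqP; rewrite addr_eq0 => /eqP E2.
  (* Up to sign, ['X^(k+1)] is the difference of the two operators compared here. *)
  have Cassini u : act ('X * U k.+1 ^+ 2) u = act ('X * U k * U k.+2) u ->
      act 'X^(k.+1) u = 0.
    have -> : 'X^(k.+1) = (-1)^+k.+1 * ((- 'X) ^+ k.+1) :> {poly R}.
      by rewrite -exprMn mulN1r opprK.
    move=> E; rewrite pactM -[(- 'X) ^+ _]opprK -lucasU_cassini.
    by rewrite mulrBr opprB mulrA pactDl pactNl E subrr linear0.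
  (* Applying [U k.+2] to the first equation and [D] times [U k.+1] to the second eliminates [b];
     [a] is eliminated similarly below. *)
  have a0 : act 'X^(k.+1) a = 0.
    apply: Cassini; rewrite expr2 pactDXM pactM E2 [in RHS]mulrC pactM.
    by rewrite -[act ('X * _) a]opprK -E1 !linearN /= -!pactM -pactD mulrC.
  have b0 : act 'X^(k.+1) b = 0.
    apply: Cassini; rewrite expr2 pactDXM pactM E1 [in RHS]pactM.
    by rewrite -[act (U k.+2) b]opprK -E2 !linearN /= -!pactM -pactD mulrC.
  (* The error [e] is killed by both [U k.+2] and ['X^(k+1)]. These are coprime, as [U k.+2] has a
     nonzero constant term, so a Bezout relation forces [e = 0]. *)
  split=> //; apply/eqP; rewrite -subr_eq0; apply/eqP; set e := _ - _.
  have eU : act (U k.+2) e = 0.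
    rewrite linearB /= -[in X in X = _](opprK (act _ b)) -E2 -pactM -opprD -pactDl.
    by rewrite addrC EQ mulrC pactM -pactD a0 !linear0.
  have eX : act 'X^(k.+1) e = 0.
    by rewrite linearB /= b0 sub0r pactCA -pactD a0 !linear0.
  have : coprimep (U k.+2) 'X^(k.+1).
    rewrite coprimep_expr // -['X]subr0 -polyC0 coprimep_XsubC.
    by rewrite /root horner_coef0 coef0_lucasU expf_neq0 ?pnatr_eq0.
  move=> /Bezout_eq1_coprimepP [[p q] /= pq].
  rewrite -[e](pact1 (D \o D)) -pq pactDl.
  by rewrite !pactM eU eX !linear0 addr0.
move=> [a0 ->]; congr pair.
  (* The first component carries an extra factor ['X], so the congruence modulo ['X^k] suffices; the
     last term of [cpoly] also becomes a multiple of ['X^(k+1)]. *)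
  rewrite -(pactD (U k.+1)) -pactM -pactDXM -pactDl -mulrDr cpolyS
    [U _ * _]mulrDr addrAC EQ'.
  rewrite (_ : 'X * _ = (Q' + c k.+1 *: U k.+1) * 'X^(k.+1)).
    by rewrite pactM a0 linear0.
  by rewrite -!mul_polyC exprS; move: (U k.+1) => u; ring.
by rewrite -pactM -pactDl addrC EQ mulrC pactM -pactD a0 !linear0.
Qed.

End PairIteration.

(** * Symmetry of second derivatives *)

Section DirectionalDerivatives.
Variables (R : realType) (V : normedModType R).
Implicit Types (f g : V -> R) (u v x y : V).

(** A directional derivative sees only the restriction to a line, so factors constant along that
    line may be frozen. *)
Lemma derive_eq_line f g v x y :
  (forall h, f (h *: v + x) = g (h *: v + y)) -> 'D_v f x = 'D_v g y.
Proof.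
move=> E; have := E 0; rewrite !scale0r !add0r => E0.
rewrite /derive; suff -> : (fun h => h^-1 *: ((f \o shift x) (h *: v) - f x)) =
  (fun h => h^-1 *: ((g \o shift y) (h *: v) - g y)) by [].
by apply/funext => h /=; rewrite E E0.
Qed.

Lemma is_derive_line f v x d :
  is_derive (0 : R) 1 (fun h => f (h *: v + x)) d -> is_derive x v f d.
Proof.
move=> [dv <-]; split; first by apply/derivable1P.
rewrite /derive; suff -> : (fun h => h^-1 *: ((f \o shift x) (h *: v) - f x)) =
  (fun h => h^-1 *: (((fun t => f (t *: v + x)) \o shift 0) (h *: 1) -
                     f (0 *: v + x))) by [].
apply/funext => h /=.
by rewrite scale0r add0r addr0 /GRing.scale/= mulr1.
Qed.

Lemma is_derive_along f u w (s : R) : (forall x, differentiable f x) ->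
  is_derive s 1 (fun t => f (t *: u + w)) ('D_u f (s *: u + w)).
Proof.
move=> df.
suff E : (fun h : R =>
         h^-1 *: (((fun t => f (t *: u + w)) \o shift s) (h *: 1) - f (s *: u + w)))
       = (fun h => h^-1 *: ((f \o shift (s *: u + w)) (h *: u) - f (s *: u + w))).
  have : derivable f (s *: u + w) u by exact: diff_derivable.
  by rewrite /derivable /derive -E; split.
by apply/funext => h /=; rewrite scalerDl -addrA /GRing.scale/= mulr1.
Qed.

(** The mean value theorem is applied twice: along [u] to the increment of [f] in direction [v],
    then along [v] to ['D_u f]. *)
Lemma second_difference f u v a (h : R) :
  (forall x, differentiable f x) -> (forall x, differentiable ('D_u f) x) -> 0 < h ->
  exists xi eta : R, [/\ 0 < xi < h, 0 < eta < h &
    f (h *: u + (h *: v + a)) - f (h *: u + a) - (f (h *: v + a) - f a)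
    = 'D_v ('D_u f) (eta *: v + (xi *: u + a)) * h * h].
Proof.
move=> df duf h0.
pose phi (s : R) : R := f (s *: u + (h *: v + a)) - f (s *: u + a).
pose dphi (s : R) : R := 'D_u f (s *: u + (h *: v + a)) - 'D_u f (s *: u + a).
have dphiP (s : R) : is_derive s (1 : R) phi (dphi s).
  by apply: is_deriveB; exact: is_derive_along.
have [|xi xih] := @MVT R phi dphi 0 h h0 (fun s _ => dphiP s).
  apply: derivable_within_continuous => s _; exact: ex_derive.
rewrite subr0 /phi !scale0r !add0r => ->.
pose psi (t : R) : R := 'D_u f (t *: v + (xi *: u + a)).
have dpsiP (t : R) : is_derive t (1 : R) psi ('D_v ('D_u f) (t *: v + (xi *: u + a))).
  exact: is_derive_along.
have [|eta etah] := @MVT R psi _ 0 h h0 (fun s _ => dpsiP s).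
  apply: derivable_within_continuous => s _; exact: ex_derive.
rewrite subr0 /psi !scale0r !add0r => E.
exists xi, eta; split; rewrite -?in_itv //.
by rewrite -E /dphi addrCA.
Qed.

Lemma eq_small_box_values (L1 L2 : V -> R) (delta : R -> R) u v a :
  {for a, continuous L1} -> {for a, continuous L2} ->
  (forall h : R, 0 < h -> exists xi eta : R, [/\ 0 < xi < h, 0 < eta < h &
    delta h = L1 (eta *: v + (xi *: u + a)) * h * h]) ->
  (forall h : R, 0 < h -> exists xi eta : R, [/\ 0 < xi < h, 0 < eta < h &
    delta h = L2 (eta *: u + (xi *: v + a)) * h * h]) ->
  L1 a = L2 a.
Proof.
move=> cvu cuv diff1 diff2.
apply/eqP; rewrite -subr_eq0 -normr_le0.
apply/ler_addgt0Pl => e e0; rewrite addr0.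
have e2 : 0 < e / 2 by rewrite divr_gt0.
have /cvgrPdist_lt /(_ _ e2) /nbhs_normP [d1 /= d10 H1] := cvu.
have /cvgrPdist_lt /(_ _ e2) /nbhs_normP [d2 /= d20 H2] := cuv.
pose d := Num.min d1 d2; have d0 : 0 < d by rewrite lt_min d10.
(* With this side the whole box lies within [d] of [a]; the summand 1 prevents a zero denominator
   and makes the bound strict. *)
pose h := d / (`|u| + `|v| + 1).
have n0 : 0 < `|u| + `|v| + 1 by rewrite ltr_wpDl ?addr_ge0.
have h0 : 0 < h by rewrite divr_gt0.
have near s t : 0 < s < h -> 0 < t < h -> `|s *: u + t *: v| < d.
  move=> /andP[s0 sh] /andP[t0 th].
  rewrite (le_lt_trans (ler_normD _ _)) // !normrZ !gtr0_norm //.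
  have -> : d = h * `|u| + h * `|v| + h by rewrite -[LHS](divfK (lt0r_neq0 n0)) /h; ring.
  have su : s * `|u| <= h * `|u| by rewrite ler_wpM2r // ltW.
  have tv : t * `|v| <= h * `|v| by rewrite ler_wpM2r // ltW.
  by rewrite ltr_pwDr // lerD.
have [x1 [y1 [x1h y1h E1]]] := diff1 h h0.
have [x2 [y2 [x2h y2h E2]]] := diff2 h h0.
set p := y1 *: v + (x1 *: u + a) in E1; set q := y2 *: u + (x2 *: v + a) in E2.
have E : L1 p = L2 q.
  apply: (mulIf (lt0r_neq0 h0)); apply: (mulIf (lt0r_neq0 h0)); by rewrite -E1 -E2.
have hp : `|L1 a - L1 p| < e / 2.
  have pE : a - p = - (x1 *: u + y1 *: v).
    by rewrite /p addrA (addrC (y1 *: v)) opprD addrCA subrr addr0.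
  apply: H1; change (`|a - p| < d1); rewrite pE normrN.
  by apply: lt_le_trans (near _ _ x1h y1h) _; rewrite /d ge_min lexx.
have hq : `|L2 a - L2 q| < e / 2.
  have qE : a - q = - (y2 *: u + x2 *: v).
    by rewrite /q addrA opprD addrCA subrr addr0.
  apply: H2; change (`|a - q| < d2); rewrite qE normrN.
  by apply: lt_le_trans (near _ _ y2h x2h) _; rewrite /d ge_min lexx orbT.
rewrite (splitr e); apply: le_trans (ler_distD (L1 p) _ _) _.
by apply: lerD; [exact: ltW|rewrite E distrC; exact: ltW].
Qed.
(** The second difference is symmetric in [u] and [v]; divided by [h^2] it is a value of either
    mixed derivative at a point tending to [a]. *)
Lemma derive_comm f u v a :
  (forall x, differentiable f x) ->
  (forall x, differentiable ('D_u f) x) -> (forall x, differentiable ('D_v f) x) ->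
  {for a, continuous ('D_v ('D_u f))} -> {for a, continuous ('D_u ('D_v f))} ->
  'D_v ('D_u f) a = 'D_u ('D_v f) a.
Proof.
move=> df du dv cvu cuv.
apply: (eq_small_box_values cvu cuv (delta := fun h =>
    f (h *: u + (h *: v + a)) - f (h *: u + a) - (f (h *: v + a) - f a))) => h h0.
  exact: second_difference.
have [xi [eta [xih etah E]]] := second_difference u a df dv h0.
exists xi, eta; split => //; rewrite -E [h *: u + (h *: v + a)]addrCA.
ring.
Qed.

End DirectionalDerivatives.

(** * Clifford product and smooth functions *)

Section CliffordAlgebra.
Variables (R : realType) (m : nat).
Implicit Types (S T U : {set 'I_m}) (i j : 'I_m) (a b c : Cl R m).

Lemma in_symdiff S T i : (i \in symdiff S T) = (i \in S) (+) (i \in T).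
Proof. by rewrite !inE; case: (i \in S); case: (i \in T). Qed.

Lemma symdiffK S T : symdiff S (symdiff S T) = T.
Proof. by apply/setP => i; rewrite !in_symdiff addKb. Qed.

Lemma symdiffCA S T U : symdiff S (symdiff T U) = symdiff T (symdiff S U).
Proof. by apply/setP => i; rewrite !in_symdiff addbCA. Qed.

(** Only [T = symdiff S U] satisfies [symdiff S T = U], so one term survives. *)
Lemma clmul_blade S a U :
  clmul (blade R S) a U = clsign R S (symdiff S U) * a (symdiff S U).
Proof.
rewrite ffunE (bigD1 S) //= [X in _ + X]big1 ?addr0; last first.
  move=> T TS; rewrite big1 // => T' _.
  by rewrite ffunE (negbTE TS) mulr0 mul0r.
rewrite (big_pred1 (symdiff S U)) => [|T /=]; first by rewrite ffunE eqxx mulr1.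
by rewrite eq_sym; apply/eqP/eqP => [->|->]; rewrite symdiffK.
Qed.

Lemma clmul_is_linear a : linear (clmul a).
Proof.
move=> k b c; apply/ffunP => U; rewrite !ffunE scaler_sumr -big_split /=.
apply: eq_bigr => S _; rewrite scaler_sumr -big_split /=.
by apply: eq_bigr => T _; rewrite !ffunE /GRing.scale/=; ring.
Qed.
HB.instance Definition _ a :=
  GRing.isLinear.Build R (Cl R m) (Cl R m) _ (clmul a) (clmul_is_linear a).

Lemma clmul_linearl k a b c : clmul (k *: a + b) c = k *: clmul a c + clmul b c.
Proof.
apply/ffunP => U; rewrite !ffunE scaler_sumr -big_split /=.
apply: eq_bigr => S _; rewrite scaler_sumr -big_split /=.
by apply: eq_bigr => T _; rewrite !ffunE /GRing.scale/=; ring.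
Qed.

Lemma clmulZl k a b : clmul (k *: a) b = k *: clmul a b.
Proof.
apply/ffunP => U; rewrite !ffunE scaler_sumr.
apply: eq_bigr => S _; rewrite scaler_sumr.
by apply: eq_bigr => T _; rewrite !ffunE /GRing.scale/=; ring.
Qed.

Lemma clmul1 a : clmul (clone R m) a = a.
Proof.
apply/ffunP => U; rewrite clmul_blade /clsign.
have -> : symdiff [set _ | false] U = U.
  by apply/setP => i; rewrite in_symdiff inE.
rewrite (_ : [set p | _] = finset.set0) ?cards0; last by apply/setP => p; rewrite !inE.
by rewrite (_ : _ :&: _ = finset.set0) ?cards0 ?mul1r //; apply/setP => p; rewrite !inE.
Qed.

(* The sign in [e_i e_T = +- e_S], where [S] is the symmetric difference of [T] and [{i}]. *)
Definition gen_sign i T : R := \prod_(q : 'I_m | (q <= i)%N) (-1) ^+ (q \in T).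

(** Elements of [T] below [i] count transpositions, and [i] itself, if present, contributes
    [e_i^2 = -1]; together they are the elements up to [i]. *)
Lemma clsign_gen i T : clsign R [set i] T = gen_sign i T.
Proof.
rewrite /clsign /gen_sign -expr_sum; congr (_ ^+ _).
rewrite (bigD1 i) //= addnC; congr (_ + _)%N.
  case: (boolP (i \in T)) => iT.
    by rewrite (finset.setIidPl _) ?cards1 // finset.sub1set.
  apply/eqP; rewrite cards_eq0; apply/eqP/setP => q; rewrite !inE.
  by case: eqP => // ->; rewrite (negbTE iT).
have -> : [set p : 'I_m * 'I_m | (p.1 \in [set i]) && (p.2 \in T) && (p.2 < p.1)%N]
          = [set (i, q) | q in [set q in T | (q < i)%N]].
  apply/setP => -[x y]; apply/idP/imsetP => [|[q]].
    by rewrite !inE /= => /andP[/andP[/eqP -> yT] yi]; exists y; rewrite // inE yT.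
  by rewrite !inE => /andP[qT qi] [-> ->]; rewrite /= eqxx qT.
rewrite card_imset => [|x y []] //.
rewrite -sum1_card big_mkcond [RHS]big_mkcond; apply: eq_bigr => q _.
rewrite inE ltn_neqAle -val_eqE /=.
by case: (q \in T); case: (q <= i)%N; case: (val q == val i).
Qed.

Lemma clmul_gen i a U :
  clmul (gen R i) a U = gen_sign i (symdiff [set i] U) * a (symdiff [set i] U).
Proof.
have -> : gen R i = blade R [set i].
  by congr blade; apply/setP => q; rewrite !inE.
by rewrite clmul_blade clsign_gen.
Qed.

Lemma gen_sign_symdiff i j T :
  gen_sign i (symdiff [set j] T) = (-1) ^+ (j <= i)%N * gen_sign i T.
Proof.
rewrite /gen_sign (eq_bigr (fun q => (-1) ^+ (q == j) * (-1) ^+ (q \in T))); last first.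
  by move=> q _; rewrite in_symdiff inE signr_addb.
rewrite big_split /=; congr (_ * _).
case: (boolP (j <= i)%N) => ji.
  by rewrite (bigD1 j) //= eqxx big1 ?mulr1 // => q /andP[_ /negbTE ->].
rewrite big1 // => q qi; case: eqP => // qj; by rewrite -qj qi in ji.
Qed.

(** For distinct indices exactly one of [i <= j] and [j <= i] holds, so exactly one order of
    multiplication picks up an extra sign. *)
Lemma gen_anticomm i j a : i != j ->
  clmul (gen R i) (clmul (gen R j) a) = - clmul (gen R j) (clmul (gen R i) a).
Proof.
move=> ij; apply/ffunP => U; rewrite [RHS]ffunE !clmul_gen !gen_sign_symdiff.
rewrite (symdiffCA [set j]) !leqnn.
have := ij; rewrite neq_ltn => /orP[] lt_ij; rewrite (ltnW lt_ij) leqNgt lt_ij /=; ring.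
Qed.

Lemma gen_sqr i a : clmul (gen R i) (clmul (gen R i) a) = - a.
Proof.
apply/ffunP => U; rewrite [RHS]ffunE !clmul_gen !gen_sign_symdiff !symdiffK leqnn.
have : gen_sign i U ^+ 2 = 1.
  by rewrite /gen_sign -prodrXl big1 // => q _; rewrite -exprM mulnC exprM sqrrN !expr1n.
move=> s; transitivity (- (gen_sign i U ^+ 2 * a U)).
  by rewrite expr1; ring.
by rewrite s mul1r.
Qed.

End CliffordAlgebra.

(** * The module of smooth functions of [y] *)

Section SmoothFunctions.
Variables (R : realType) (m : nat).
Local Notation pt := ('rV[R]_m.+1).
Implicit Types (f g : pt -> R) (F G : pt -> Cl R m).

Lemma smoothR_differentiable f X : smoothR f -> differentiable f X.
Proof. by move=> /(_ [::] X). Qed.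

Lemma smoothR_pdR k f : smoothR f -> smoothR (pdR k f).
Proof. by move=> sf l X; have := sf (rcons l k) X; rewrite /ipdR foldr_rcons. Qed.

Lemma pdR_linear k (c : R) f g : smoothR f -> smoothR g ->
  pdR k (fun X => c * f X + g X) = fun X => c * pdR k f X + pdR k g X.
Proof.
move=> sf sg; apply/funext => X; rewrite /pdR.
have df := diff_derivable (smoothR_differentiable X sf).
have dg := diff_derivable (smoothR_differentiable X sg).
transitivity ('D_(delta_mx 0 k) (c \*: f + g) X) => //.
rewrite deriveD ?deriveZ //; exact: derivableZ.
Qed.

Lemma smoothR_linear (c : R) f g : smoothR f -> smoothR g ->
  smoothR (fun X => c * f X + g X).
Proof.
move=> sf sg l X.
have -> : ipdR l (fun X => c * f X + g X) = fun X => c * ipdR l f X + ipdR l g X.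
  elim: l => //= k l ->; rewrite pdR_linear // => l' Y.
    by have := sf (l' ++ l) Y; rewrite /ipdR foldr_cat.
  by have := sg (l' ++ l) Y; rewrite /ipdR foldr_cat.
by apply: differentiableD; [apply: differentiableZ|]; [apply: sf|apply: sg].
Qed.

Lemma smoothR0 : smoothR (fun _ : pt => 0 : R).
Proof.
move=> l; have -> : ipdR l (fun _ : pt => 0 : R) = fun _ => 0.
  by elim: l => //= k l ->; apply/funext => X; rewrite /pdR derive_cst.
by move=> X; exact: differentiable_cst.
Qed.

Lemma pdR_comm i j f : smoothR f -> pdR i (pdR j f) = pdR j (pdR i f).
Proof.
move=> sf; apply/funext => X; rewrite /pdR.
have sd k := smoothR_pdR k sf.
apply: derive_comm => [Y|Y|Y||].
- exact: smoothR_differentiable.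
- exact: smoothR_differentiable (sd j).
- exact: smoothR_differentiable (sd i).
- by apply: differentiable_continuous; 
  exact: smoothR_differentiable (smoothR_pdR i (sd j)).
- by apply: differentiable_continuous; 
  exact: smoothR_differentiable (smoothR_pdR j (sd i)).
Qed.

(** A Boolean predicate, obtained classically, so that its subtype [smoothY] inherits a module
    structure on which [D] can act as a linear map. *)
Definition smooth_y : {pred pt -> Cl R m} := fun F => `[< smooth F /\ only_y F >].

Lemma smooth_yP F : reflect (smooth F /\ only_y F) (F \in smooth_y).
Proof. exact: asboolP. Qed.

Lemma smooth_y_submod_closed : submod_closed smooth_y.
Proof.
split; first by apply/smooth_yP; split=> [S|//]; rewrite (_ : (fun _ => _) = fun=> 0);
  [exact: smoothR0|apply/funext => X; rewrite ffunE].
move=> c F G /smooth_yP[sF yF] /smooth_yP[sG yG]; apply/smooth_yP; split.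
  move=> S; rewrite (_ : (fun X => _) = fun X => c * F X S + G X S).
    by apply: smoothR_linear; [exact: sF|exact: sG].
  by apply/funext => X; rewrite !ffunE.
by move=> X Y XY; rewrite /GRing.scale /= /GRing.add /= (yF X Y) // (yG X Y).
Qed.
HB.instance Definition _ :=
  GRing.isSubmodClosed.Build R (pt -> Cl R m) smooth_y smooth_y_submod_closed.

Record smoothY := SmoothY { smoothY_fun :> pt -> Cl R m; _ : smoothY_fun \in smooth_y }.
HB.instance Definition _ := [isSub for smoothY_fun].
HB.instance Definition _ := [Choice of smoothY by <:].
HB.instance Definition _ := [SubChoice_isSubLmodule of smoothY by <:].

End SmoothFunctions.

(** * The Dirac operator as an endomorphism, and its square *)

Section DiracOperator.
Variables (R : realType) (m : nat).
Local Notation pt := ('rV[R]_m.+1).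
Implicit Types (f g : pt -> R) (F G : pt -> Cl R m) (A B : smoothY R m).

Lemma pdR0 k : pdR k (fun _ : pt => 0 : R) = fun _ => 0.
Proof. by apply/funext => X; rewrite /pdR derive_cst. Qed.

Lemma smoothR_sum I (r : seq I) (P : pred I) (f : I -> pt -> R) :
  (forall i, smoothR (f i)) -> smoothR (fun X => \sum_(i <- r | P i) f i X).
Proof.
move=> sf; elim: r => [|i r IH].
  by under eq_fun do rewrite big_nil; exact: smoothR0.
under eq_fun do rewrite big_cons; case: (P i) => //.
by under eq_fun do rewrite -[f i _]mul1r; exact: smoothR_linear.
Qed.

Lemma pdR_sum k I (r : seq I) (P : pred I) (f : I -> pt -> R) :
  (forall i, smoothR (f i)) ->
  pdR k (fun X => \sum_(i <- r | P i) f i X) = fun X => \sum_(i <- r | P i) pdR k (f i) X.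
Proof.
move=> sf; elim: r => [|i r IH].
  by under eq_fun do rewrite big_nil; rewrite pdR0; under [RHS]eq_fun do rewrite big_nil.
under eq_fun do rewrite big_cons; under [RHS]eq_fun do rewrite big_cons.
case: (P i) => //; under eq_fun do rewrite -[f i _]mul1r.
rewrite pdR_linear //; last exact: smoothR_sum.
by rewrite IH; apply/funext => X; rewrite mul1r.
Qed.

Lemma smoothRZ (c : R) f : smoothR f -> smoothR (fun X => c * f X).
Proof.
move=> sf; under eq_fun do rewrite -[_ * _]addr0.
by apply: smoothR_linear sf (@smoothR0 _ _).
Qed.

Lemma pdRZ k (c : R) f : smoothR f -> pdR k (fun X => c * f X) = fun X => c * pdR k f X.
Proof.
move=> sf; under eq_fun do rewrite -[_ * _]addr0.
by rewrite pdR_linear ?pdR0//; [under eq_fun do rewrite addr0|exact: smoothR0].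
Qed.

Lemma smooth_pd k F : smooth F -> smooth (pd k F).
Proof.
by move=> sF S; under eq_fun do rewrite ffunE; exact: smoothR_pdR (sF S).
Qed.

Lemma clmulE (a b : Cl R m) U : clmul a b U =
  \sum_S \sum_(T | symdiff S T == U) (clsign R S T * a S) * b T.
Proof. by rewrite ffunE. Qed.

Lemma smooth_clmul (a : Cl R m) F : smooth F -> smooth (fun X => clmul a (F X)).
Proof.
move=> sF U; under eq_fun do rewrite clmulE.
by do 2 apply: smoothR_sum => ?; apply: smoothRZ; exact: sF.
Qed.

Lemma pd_clmul k (a : Cl R m) F : smooth F ->
  pd k (fun X => clmul a (F X)) = fun X => clmul a (pd k F X).
Proof.
move=> sF; apply/funext => X; apply/ffunP => U; rewrite ffunE clmulE.
under eq_fun do rewrite clmulE.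
rewrite pdR_sum => [|S]; last first.
  by apply: smoothR_sum => T; apply: smoothRZ; exact: sF.
apply: eq_bigr => S _; rewrite pdR_sum => [|T]; last by apply: smoothRZ; exact: sF.
by apply: eq_bigr => T _; rewrite ffunE pdRZ //; exact: sF.
Qed.

Lemma smooth_sum I (r : seq I) (P : pred I) (F : I -> pt -> Cl R m) :
  (forall i, smooth (F i)) -> smooth (fun X => \sum_(i <- r | P i) F i X).
Proof.
move=> sF S; under eq_fun do rewrite sum_ffunE.
by apply: smoothR_sum => i; exact: sF.
Qed.

Lemma pd_sum k I (r : seq I) (P : pred I) (F : I -> pt -> Cl R m) :
  (forall i, smooth (F i)) ->
  pd k (fun X => \sum_(i <- r | P i) F i X) = fun X => \sum_(i <- r | P i) pd k (F i) X.
Proof.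
move=> sF; apply/funext => X; apply/ffunP => S; rewrite ffunE sum_ffunE.
under eq_fun do rewrite sum_ffunE.
rewrite pdR_sum => [|i]; last exact: sF.
by apply: eq_bigr => i _; rewrite ffunE.
Qed.

Lemma pd_linear k (c : R) F G : smooth F -> smooth G ->
  pd k (c *: F + G) = c *: pd k F + pd k G.
Proof.
move=> sF sG; apply/funext => X; apply/ffunP => S; rewrite !ffunE.
have := pdR_linear k c (sF S) (sG S) => /(congr1 (fun f => f X)) <-.
by congr (pdR k _ X); apply/funext => Y; rewrite !ffunE.
Qed.

Lemma pd_comm i j F : smooth F -> pd i (pd j F) = pd j (pd i F).
Proof.
move=> sF; apply/funext => X; apply/ffunP => S.
have pdE k l : pd k (pd l F) X S = pdR k (pdR l (fun Y => F Y S)) X.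
  by rewrite ffunE; congr (pdR k _ X); apply/funext => Y; rewrite ffunE.
have C := congr1 (fun f : pt -> R => f X) (pdR_comm i j (sF S)).
exact: (etrans (pdE i j) (etrans C (esym (pdE j i)))).
Qed.

Lemma only_y_pd k F : only_y F -> only_y (pd k F).
Proof.
move=> yF X Y XY; apply/ffunP => S; rewrite !ffunE; apply: derive_eq_line => h.
by rewrite (yF _ (h *: delta_mx 0 k + Y)) // => l l2; rewrite !mxE XY.
Qed.

Lemma smoothYP A : smooth A /\ only_y A.
Proof. by apply/smooth_yP; case: A. Qed.

Lemma Dy_smooth_y A : Dy A \in @smooth_y R m.
Proof.
have [sA yA] := smoothYP A; apply/smooth_yP; split.
  by apply: smooth_sum => i; apply: smooth_clmul; apply: smooth_pd.
move=> X Y XY; apply: eq_bigr => i _; congr (clmul _ _).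
exact: only_y_pd XY.
Qed.

Definition dirac_op A : smoothY R m := SmoothY (Dy_smooth_y A).

Lemma dirac_op_is_linear : linear dirac_op.
Proof.
move=> c A B; apply: val_inj; apply/funext => X /=.
have [sA _] := smoothYP A; have [sB _] := smoothYP B.
rewrite -[RHS]/(c *: Dy A X + Dy B X) /Dy scaler_sumr -big_split /=.
by apply: eq_bigr => i _; rewrite pd_linear // linearP.
Qed.
HB.instance Definition _ :=
  GRing.isLinear.Build R (smoothY R m) (smoothY R m) _ dirac_op dirac_op_is_linear.

Lemma Lap_dirac_op A : Lap A = - (dirac_op (dirac_op A) : pt -> Cl R m).
Proof.
have [sA _] := smoothYP A; apply/funext => X.
pose e (i : 'I_m) : Cl R m := gen R i.
pose p (i : 'I_m) := pd (R := R) (m := m) (lift ord0 i).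
have D2E : dirac_op (dirac_op A) X =
    \sum_(i : 'I_m | (0 < i)%N) \sum_(j : 'I_m | (0 < j)%N)
    clmul (e i) (clmul (e j) (p i (p j A) X)).
  apply: eq_bigr => i _.
  rewrite pd_sum => [|j]; last by apply: smooth_clmul; exact: smooth_pd.
  rewrite linear_sum; apply: eq_bigr => j _ /=.
  by rewrite pd_clmul //; exact: smooth_pd.
(* Adding the double sum to its transpose pairs [e_i e_j] with [e_j e_i]: off the diagonal they
   cancel, by symmetry of second derivatives, and the diagonal gives [-2] times the second
   derivatives. *)
have D2E2 : dirac_op (dirac_op A) X *+ 2 = - Lap A X *+ 2.
  rewrite mulr2n {1}D2E exchange_big D2E -big_split -sumrN -sumrMnl /=.
  apply: eq_bigr => i i0; rewrite -big_split (bigD1 i) //=.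
  rewrite big1 ?addr0 => [|j /andP[_ ji]].
    by rewrite gen_sqr -mulr2n.
  by rewrite /p pd_comm // (gen_anticomm _ ji) addNr.
change (Lap A X = - dirac_op (dirac_op A) X); apply: (canRL opprK).
have n2 : (2%:R : R) != 0 by rewrite pnatr_eq0.
apply/(scalerI n2); rewrite (scaler_nat 2 (- Lap A X))
  (scaler_nat 2 (dirac_op (dirac_op A) X)).
by rewrite D2E2.
Qed.

End DiracOperator.

(** * The operator [DX] on [exp(z) A + exp(zbar) B] *)

Section ExponentialFunctions.
Variables (R : realType) (m : nat).
Hypothesis hm : (2 <= m)%N.
Local Notation pt := ('rV[R]_m.+1).
Implicit Types (X : pt) (A B G H : smoothY R m).

Let i0 : 'I_m := Ordinal (ltnW hm).
Local Notation k1 := (lift ord0 i0).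
Local Notation I a := (clmul (e1 R m) a).

Lemma coord0E X : Defs.coord X 0 = X 0 ord0.
Proof. by rewrite /Defs.coord; congr (X _ _); apply/val_inj; rewrite /= inordK. Qed.

Lemma coord1E X : Defs.coord X 1 = X 0 k1.
Proof.
by rewrite /Defs.coord; congr (X _ _); apply/val_inj; rewrite /= inordK // ltnS ltnW.
Qed.

Lemma e1E : e1 R m = gen R i0.
Proof. by congr blade; apply/setP => i; rewrite !inE -val_eqE. Qed.

Definition expcos X : R := expR (Defs.coord X 0) * cos (Defs.coord X 1).
Definition expsin X : R := expR (Defs.coord X 0) * sin (Defs.coord X 1).

(* [e^x0 cos x1 G + e^x0 sin x1 H], a form in which [x0, x1] only enter through
   real factors; [exp(z) A + exp(zbar) B] is the case [G = A + B], [H = e1 (A - B)]. *)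
Definition trigsum (G H : pt -> Cl R m) X : Cl R m := expcos X *: G X + expsin X *: H X.

Lemma expzE (A B : pt -> Cl R m) :
  (fun X => clmul (expz X) (A X) + clmul (expzbar X) (B X)) =
  trigsum (fun X => A X + B X) (fun X => I (A X - B X)).
Proof.
apply/funext => X; rewrite /trigsum /expz /expzbar -/(expcos X) -/(expsin X).
rewrite -scaleNr !clmul_linearl !clmul1.
rewrite !clmulZl.
by rewrite linearB /= !scalerDr scalerN scaleNr addrACA.
Qed.

Lemma pd0_trigsum G H X : pd ord0 (trigsum G H) X = trigsum G H X.
Proof.
have [_ yG] := smoothYP G; have [_ yH] := smoothYP H.
apply/ffunP => S; rewrite ffunE /pdR; apply: derive_val; apply: is_derive_line.
have E Z (h : R) : only_y Z -> Z (h *: delta_mx 0 ord0 + X) = Z X :> Cl R m.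
  apply => k k2; rewrite !mxE (_ : k == ord0 = false) ?andbF ?mulr0 ?add0r //.
  by case: k k2 => -[].
under eq_fun do
  rewrite /trigsum !ffunE /expcos /expsin !E // !coord0E !coord1E !mxE /= mulr1 mulr0 add0r.
apply: is_derive_eq; rewrite /trigsum !ffunE /expcos /expsin coord0E coord1E.
by rewrite /GRing.scale/= add0r; ring.
Qed.

Lemma pd1_trigsum G H X :
  pd k1 (trigsum G H) X = - expsin X *: G X + expcos X *: H X.
Proof.
have [_ yG] := smoothYP G; have [_ yH] := smoothYP H.
apply/ffunP => S; rewrite ffunE /pdR; apply: derive_val; apply: is_derive_line.
have E Z (h : R) : only_y Z -> Z (h *: delta_mx 0 k1 + X) = Z X :> Cl R m.
  apply => k k2; rewrite !mxE (_ : k == k1 = false) ?andbF ?mulr0 ?add0r //.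
  by apply/negP => /eqP kk; rewrite kk in k2.
under eq_fun do
  rewrite /trigsum !ffunE /expcos /expsin !E // !coord0E !coord1E !mxE /= mulr1 mulr0 add0r.
apply: is_derive_eq; rewrite !ffunE /expcos /expsin coord0E coord1E.
by rewrite /GRing.scale/= add0r; ring.
Qed.

Lemma pdy_trigsum (i : 'I_m) G H X : (0 < i)%N ->
  pd (lift ord0 i) (trigsum G H) X =
  expcos X *: pd (lift ord0 i) G X + expsin X *: pd (lift ord0 i) H X.
Proof.
move=> i_gt0; have [sG yG] := smoothYP G; have [sH yH] := smoothYP H.
apply/ffunP => S; rewrite !ffunE.
have sHS := smoothRZ (expsin X) (sH S).
(* Along a [y] direction the real factors are constant, so they are frozen at [X]. *)
have -> : pdR (lift ord0 i) (fun Y => trigsum G H Y S) X =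
    pdR (lift ord0 i) (fun Y => expcos X * G Y S + expsin X * H Y S) X.
  apply: derive_eq_line => h.
  rewrite /trigsum !ffunE /expcos /expsin !coord0E !coord1E !mxE /=.
  have -> : (k1 == lift ord0 i) = false.
    by apply/negP => /eqP /lift_inj ii; rewrite -ii in i_gt0.
  by rewrite mulr0 !add0r.
by rewrite pdR_linear // pdRZ.
Qed.

Lemma DX_trigsum G H X : DX (trigsum G H) X =
  trigsum (fun X => G X + I (H X) + Dy G X) (fun X => H X - I (G X) + Dy H X) X.
Proof.
rewrite /DX pd0_trigsum (bigD1 i0) //= pd1_trigsum -e1E.
have -> : \sum_(i < m | i != i0) clmul (gen R i) (pd (lift ord0 i) (trigsum G H) X)
    = expcos X *: Dy G X + expsin X *: Dy H X.
  rewrite /Dy !scaler_sumr -big_split; apply: eq_big => [i|i i_neq].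
    by rewrite -val_eqE lt0n.
  rewrite pdy_trigsum ?lt0n -?val_eqE // linearD !linearZ //.
have IL c d g h : I (c *: g + d *: h) = c *: I g + d *: I h by rewrite linearD !linearZ.
rewrite IL /trigsum.
move: (I (G X)) (I (H X)) (Dy G X) (Dy H X) (G X) (H X) => IG IH DG DH g h.
by apply/ffunP => U; rewrite !ffunE /GRing.scale/=; ring.
Qed.

Definition expsum (AB : smoothY R m * smoothY R m) : pt -> Cl R m :=
  fun X => clmul (expz X) (AB.1 X) + clmul (expzbar X) (AB.2 X).

Lemma I_smooth_y G : (fun X => I (G X)) \in @smooth_y R m.
Proof.
have [sG yG] := smoothYP G; apply/smooth_yP; split; first exact: smooth_clmul.
by move=> X Y XY; rewrite (yG X Y).
Qed.

(** The generator [e_1] anticommutes with every generator in [Dy]; this is why [D] exchanges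
    [exp(z)] and [exp(zbar)]. *)
Lemma Dy_I G X : Dy (fun Y => I (G Y)) X = - I (Dy G X).
Proof.
have [sG yG] := smoothYP G.
rewrite /Dy linear_sum -sumrN; apply: eq_bigr => i i_gt0.
rewrite pd_clmul // e1E gen_anticomm //.
by apply/negP => /eqP E; rewrite E in i_gt0.
Qed.

(** With [G = A + B] and [H = e_1 (A - B)], the new pair is [G' = D B + (D A + 2 B)] and
    [H' = e_1 (D B - (D A + 2 B))], of the same shape. *)
Lemma DX_expsum AB : DX (expsum AB) = expsum (pair_step (@dirac_op R m) AB).
Proof.
case: AB => A B; rewrite /expsum !expzE /=; apply/funext => X.
transitivity (DX (trigsum (A + B) (SmoothY (I_smooth_y (A - B)))) X) => //.
rewrite DX_trigsum /=.
have DD : Dy (A + B) X = Dy A X + Dy B X.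
  by have := congr1 (fun F : smoothY R m => F X) (linearD (@dirac_op R m) A B).
have DB : Dy (A - B) X = Dy A X - Dy B X.
  by have := congr1 (fun F : smoothY R m => F X) (linearB (@dirac_op R m) A B).
have DI : Dy (fun Y => I ((A - B) Y)) X = - I (Dy A X - Dy B X).
  by rewrite -DB; exact: (Dy_I (A - B)).
have II a : I (I a) = - a by rewrite e1E gen_sqr.
have IB u v w : I u - I v + - I w = I (u - v - w) by rewrite !linearB.
rewrite /trigsum DI DD II IB.
congr (_ *: _ + _ *: I _); apply/ffunP => U; rewrite !ffunE /GRing.scale/=; ring.
Qed.

Lemma iter_DX_expsum n AB :
  iter n (@DX R m) (expsum AB) = expsum (iter n (pair_step (@dirac_op R m)) AB).
Proof. by elim: n => //= n ->; rewrite DX_expsum. Qed.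

Lemma expsum_eq0 AB : (forall X, expsum AB X = 0) -> AB = 0.
Proof.
case: AB => A B ABX0.
have AB0 X : trigsum (fun X => A X + B X) (fun X => I (A X - B X)) X = 0.
  by rewrite -expzE; exact: ABX0.
have [_ yA] := smoothYP A; have [_ yB] := smoothYP B.
suff AB X : A X + B X = 0 /\ I (A X - B X) = 0.
  have A0 X : A X = B X.
    have [_ /(congr1 (fun a => I a))] := AB X.
    by rewrite e1E gen_sqr linear0 => /eqP; rewrite oppr_eq0 subr_eq0 => /eqP.
  have B0 X : B X = 0.
    have [+ _] := AB X; rewrite A0 -mulr2n -scaler_nat => /eqP.
    by rewrite scaler_eq0 pnatr_eq0 => /eqP.
  by congr pair; apply: val_inj; apply/funext => X /=; rewrite ?A0 B0.
(* Same [y] as [X], with [x0 = 0] and [x1 = t]; the values [t = 0] and [t = pi / 2] isolate the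
   cosine and the sine coefficient. *)
pose Xt (t : R) : pt := \row_k (if k == ord0 then 0 else if k == k1 then t else X 0 k).
have E t : trigsum (fun X => A X + B X) (fun X => I (A X - B X)) (Xt t) =
    cos t *: (A X + B X) + sin t *: I (A X - B X).
  have XtX k : (2 <= val k)%N -> Xt t 0 k = X 0 k.
    move=> k2; rewrite mxE; case: eqP => [kk|_]; first by rewrite kk in k2.
    by case: eqP => [kk|//]; rewrite kk in k2.
  rewrite /trigsum /expcos /expsin coord0E coord1E !mxE /= expR0 !mul1r.
  by rewrite (yA _ _ XtX) (yB _ _ XtX).
have := AB0 (Xt 0); rewrite E cos0 sin0 scale1r scale0r addr0 => ->.
by have := AB0 (Xt (pi / 2)); rewrite E cos_pihalf sin_pihalf scale1r scale0r add0r => ->.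
Qed.

End ExponentialFunctions.

Theorem theorem4 (R : realType) (m : nat) (hm : (2 <= m)%N) (n : nat) (hn : (1 <= n)%N)
  (A B : 'rV[R]_(m.+1) -> Cl R m)
  (sA : smooth A) (sB : smooth B) (yA : only_y A) (yB : only_y B) :
  let F := fun X => clmul (expz X) (A X) + clmul (expzbar X) (B X) in
  (forall X, iter n (@DX R m) F X = 0) <->
  ((forall X, iter n (@Lap R m) A X = 0) /\
   (forall X, B X = \sum_(1 <= k < n.+1) cconst R k *: iter (k.*2.-1) (@Dy R m) A X)).
Proof.
move=> F.
pose a := SmoothY (introT (smooth_yP A) (conj sA yA)).
pose b := SmoothY (introT (smooth_yP B) (conj sB yB)).
have iterDy k : iter k (@Dy R m) A = iter k (@dirac_op R m) a by elim: k => //= k ->.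
(* The sign [(-1)^n] from [Lap = - D^2] does not affect vanishing. *)
have iterLap : iter n (@Lap R m) A =
    ((-1) ^+ n *: iter n (@dirac_op R m \o @dirac_op R m) a : smoothY R m).
  elim: n {hn} => [|k IH]; first by rewrite expr0 scale1r.
  rewrite iterS IH Lap_dirac_op -[LHS]/(smoothY_fun (- dirac_op (dirac_op _))).
  congr smoothY_fun; rewrite exprS -scalerA scaleN1r iterS; congr (- _).
  by rewrite [dirac_op (_ *: _)]linearZ /= [LHS]linearZ.
have sumE X : \sum_(1 <= k < n.+1) cconst R k *: iter (k.*2.-1) (@Dy R m) A X =
    (\sum_(1 <= k < n.+1) cconst R k *: iter (k.*2.-1) (@dirac_op R m) a : smoothY R m) X.
  elim/big_rec2: _ => [//|k u v _ ->]; by rewrite iterDy.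
have key := iter_pair_step_eq0 (@dirac_op R m) a b hn.
split.
  move=> F0; have /key[a0 bE] : iter n (pair_step (@dirac_op R m)) (a, b) = 0.
    by apply: (expsum_eq0 hm) => X; rewrite -(iter_DX_expsum hm).
  split=> X; first by rewrite iterLap a0 scaler0.
  by rewrite sumE -bE.
move=> [L0 BE].
have a0 : iter n (@dirac_op R m \o @dirac_op R m) a = 0.
  have /eqP : (-1) ^+ n *: iter n (@dirac_op R m \o @dirac_op R m) a = 0.
    by apply: val_inj; apply: etrans (esym iterLap) _; apply/funext => X; rewrite L0.
  by rewrite scaler_eq0 signr_eq0 => /eqP.
have bE : b = \sum_(1 <= k < n.+1) cconst R k *: iter (k.*2.-1) (@dirac_op R m) a.
  by apply: val_inj; apply/funext => X; rewrite /= BE sumE.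
move=> X; have := iter_DX_expsum hm n (a, b); rewrite key.2 //.
move=> /(congr1 (fun f => f X)).
rewrite [RHS]/expsum /= => ->.
by rewrite !linear0 addr0.
Qed.
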